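(* Let $\ell\ge2$, let $\theta$ be a length-$\ell$ substitution on a finite alphabet $\mathcal A$, in simplified form, and let $\mathcal S_\theta$ be the semigroup of $\theta$. Then there is a minimal deterministic finite automaton $\mathcal M_\theta$ whose state set is $\mathcal S_\theta$, with the following property: for any bi-infinite fixed point $\boldsymbol{u}=(u_n)_{n\in\mathbb Z}$ of $\theta$ with seed $u_l\cdot u_r$ (that is, $u_{-1}=u_l$ and $u_0=u_r$), there are output maps $\omega_l,\omega_r:\mathcal S_\theta\to\mathcal A$ such that $(\mathcal M_\theta,\{\omega_l,\omega_r\})$ generates $\boldsymbol{u}$ in reverse reading.
   Context: **Substitutions.** A length-$\ell$ substitution is a map $\theta:\mathcal A\to\mathcal A^\ell$, written $\theta(a)=\theta_0(a)\cdots\theta_{\ell-1}(a)$ with column maps $\theta_i:\mathcal A\to\mathcal A$. It extends by concatenation to $\mathcal A^{\mathbb Z}$, with $\theta(\boldsymbol{x})_{k\ell+r}=\theta_r(x_k)$ for $k\in\mathbb Z$, $0\le r\le\ell-1$. A fixed point is a $\boldsymbol{u}$ with $\theta(\boldsymbol{u})=\boldsymbol{u}$; its seed is $u_{-1}\cdot u_0$. $\theta$ is in simplified form if $\theta_0\circ\theta_0=\theta_0$ and $\theta_{\ell-1}\circ\theta_{\ell-1}=\theta_{\ell-1}$. **Semigroup.** $\mathcal S_\theta:=\langle \mathrm{id},\theta_i:0\le i\le\ell-1\rangle$ is the semigroup generated under composition in $\mathcal A^{\mathcal A}$ by the identity map and the column maps. **Automata.** A deterministic finite automaton (DFA) is a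 tuple $(\mathcal S,\Sigma,\delta,\mathcal S_0)$ with a finite set $\mathcal S$ of states, a finite input alphabet $\Sigma$, a transition function $\delta:\mathcal S\times\Sigma\to\mathcal S$, and a set $\mathcal S_0\subseteq\mathcal S$ of initial states. Here $\Sigma=\{0,\dots,\ell-1\}$. In reverse reading, $\delta$ extends to words by $\delta(s,n_k\cdots n_1n_0)=\delta(\delta(s,n_0),n_k\cdots n_1)$, i.e. the least significant digit $n_0$ is fed first. **Generating a sequence.** For $n\ge0$, $(n)_\ell=n_k\cdots n_0$ is the usual base-$\ell$ expansion (most significant digit on the left; $(0)_\ell=0$). For $n=-m<0$, where $m$ has a base-$\ell$ expansion of length $j$, $(n)_\ell=\cdots(\ell-1)(\ell-1)\,n_{j-1}\cdots n_0$, where $n_{j-1}\cdots n_0$ is the length-$j$ base-$\ell$ word (with leading zeros if needed) representing $\ell^j-m$. A DFA with output maps $\{\omega_l,\omega_r\}$ generates $\boldsymbol{u}\in\mathcal A^{\mathbb Z}$ in reverse reading if there are initial states $s_0,s_1$ (not necessarily distinct) such that, in reverse reading, $u_n=\omega_r(\delta(s_0,n_k\cdots n_0))$ for $n\ge0$ with $(n)_\ell=n_k\cdots n_0$, and $u_n=\omega_l(\delta(s_1,(\ell-1)\,n_{k}\cdots n_0))$ for $n<0$ with $(n)_\ell=\cdots(\ell-1)(\ell-1)\,n_k\cdots n_0$. **Minimality.** The size of an automaton is the cardinality of its state set; an automaton generating a sequence (in reverse reading) is minimal if no automaton generating that sequence in reverse reading has smaller size.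
   Formalization: Minimality is claimed only for fixed points u in which every letter of the alphabet occurs at some n ≥ 1, or every letter occurs at some n ≤ -2; without this it fails (a→aa, b→ab: two semigroup elements, but the constant fixed point a needs one state). *)

(* Defs.v *)
From HB Require Import structures.
From mathcomp Require Import all_boot all_order all_algebra.

Set Implicit Arguments.
Unset Strict Implicit.
Unset Printing Implicit Defensive.

Import Order.TTheory GRing.Theory Num.Theory.

(* The proof [hl : 1 < l] is an argument of the definitions below because they
   produce elements of the digit alphabet {0, ..., l-1} = 'I_l. *)

Definition residue l (hl : 1 < l) (n : nat) : 'I_l :=
  Ordinal (ltn_pmod n (ltnW hl)).

Definition first_digit l (hl : 1 < l) : 'I_l := residue hl 0.
Definition last_digit l (hl : 1 < l) : 'I_l := residue hl l.-1.

(* Words over 'I_l are written as usual, n_k ... n_1 n_0: the head of the list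
   is the most significant digit. *)

(* The length-j base-l word of n, with leading zeros if needed (meaningful for
   n < l ^ j). *)
Definition digit_word l (hl : 1 < l) (j n : nat) : seq 'I_l :=
  rev (mkseq (fun i => residue hl (n %/ l ^ i)) j).

(* As trunc_log l 0 = 0, this gives length 1 to n = 0. *)
Definition expansion_length (l n : nat) : nat := (trunc_log l n).+1.

Definition expansion l (hl : 1 < l) (n : nat) : seq 'I_l :=
  digit_word hl (expansion_length l n) n.

(* For - m < 0: the digits n_{j-1} ... n_0 to the right of the infinite prefix
   of digits l-1 in the expansion of - m. *)
Definition neg_expansion l (hl : 1 < l) (m : nat) : seq 'I_l :=
  let j := expansion_length l m in digit_word hl j (l ^ j - m).

Definition substitution (l : nat) (A : finType) := A -> l.-tuple A.

Definition column (l : nat) (A : finType) (theta : substitution l A)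
  (i : 'I_l) : {ffun A -> A} := [ffun a => tnth (theta a) i].

Definition simplified l (hl : 1 < l) (A : finType)
    (theta : substitution l A) : Prop :=
  idempotent_fun (column theta (first_digit hl)) /\
  idempotent_fun (column theta (last_digit hl)).

(* (n %/ l)%Z and (n %% l)%Z are the Euclidean quotient and remainder, so the
   remainder lies in {0, ..., l-1} for negative n as well; see extendE. *)
Definition extend l (hl : 1 < l) (A : finType) (theta : substitution l A)
    (x : int -> A) (n : int) : A :=
  column theta (residue hl `|(n %% (l%:Z)%R)%Z|%N) (x (n %/ (l%:Z)%R)%Z).

Lemma extendE l (hl : 1 < l) (A : finType) (theta : substitution l A)
    (x : int -> A) (k : int) (r : 'I_l) :
  extend hl theta x (k * l%:Z + r%:Z)%R = column theta r (x k).
Proof.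
have l0 : (l%:Z != 0)%R by rewrite -lt0n ltnW.
have rl : (0 <= r%:Z < `|l%:Z|)%R by rewrite /= ltz_nat ltn_ord.
rewrite /extend divzMDl // modzMDl (divz_small rl) modz_small //= addr0.
by congr (column _ _ _); apply: val_inj; rewrite /= modn_small.
Qed.

Definition fixed_point l (hl : 1 < l) (A : finType) (theta : substitution l A)
    (u : int -> A) : Prop :=
  extend hl theta u =1 u.

Definition ffun_id (A : finType) : {ffun A -> A} := [ffun a => a].

Definition ffun_comp (A : finType) (f g : {ffun A -> A}) : {ffun A -> A} :=
  [ffun a => f (g a)].

Definition comp_closed (A : finType) (G : {set {ffun A -> A}}) : bool :=
  [forall f in G, forall g in G, ffun_comp f g \in G].

Definition generated_semigroup (A : finType) (X : {set {ffun A -> A}}) :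
    {set {ffun A -> A}} :=
  \bigcap_(G : {set {ffun A -> A}} | (X \subset G) && comp_closed G) G.

Definition semigroup l (A : finType) (theta : substitution l A) :
    {set {ffun A -> A}} :=
  generated_semigroup (ffun_id A |: [set column theta i | i : 'I_l]).

(* The elements of the semigroup, as a finite type, so that they can serve as
   states. *)
Definition semigroup_type l (A : finType) (theta : substitution l A) : finType :=
  {f : {ffun A -> A} | f \in semigroup theta}.

Record dfa (Q Sigma : finType) := Dfa {
  delta : Q -> Sigma -> Q;
  initial : {set Q}
}.

(* foldr on n_k ... n_0 feeds the rightmost, least significant, digit first. *)
Definition reverse_run (Q Sigma : finType) (M : dfa Q Sigma) (s : Q)
    (w : seq Sigma) : Q :=
  foldr (fun d q => delta M q d) s w.

Definition generates l (hl : 1 < l) (A Q : finType) (M : dfa Q 'I_l)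
    (omega_l omega_r : Q -> A) (u : int -> A) : Prop :=
  exists s0 s1 : Q,
    [/\ s0 \in initial M,
        s1 \in initial M,
        (forall n : nat,
           u n%:Z%R = omega_r (reverse_run M s0 (expansion hl n))) &
        (forall m : nat, 0 < m ->
           u (- m%:Z)%R =
             omega_l (reverse_run M s1 (last_digit hl :: neg_expansion hl m)))].

Definition minimal_for l (hl : 1 < l) (A Q : finType) (M : dfa Q 'I_l)
    (u : int -> A) : Prop :=
  (exists omega_l omega_r : Q -> A, generates hl M omega_l omega_r u) /\
  forall (Q' : finType) (N : dfa Q' 'I_l) (omega_l omega_r : Q' -> A),
    generates hl N omega_l omega_r u -> #|Q| <= #|Q'|.

(* A sequence only sees the maps of the semigroup on the letters it contains.
   For a -> aa, b -> ab the semigroup has two elements, but the fixed point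
   ...aa.aa... is generated by a one-state automaton. Minimality for u therefore
   needs all the letters to occur in u. They have to occur on one common side
   of the seed because the two halves of u may be read from different initial
   states, and off the seed because expansions have no superfluous leading
   digits. *)
Definition full_on_one_side (A : finType) (u : int -> A) : Prop :=
  (forall a : A, exists2 n : int, (0 < n)%R & u n = a) \/
  (forall a : A, exists2 n : int, (n < -1)%R & u n = a).

(* Main.v *)
Require Import Defs.
From mathcomp Require Import all_boot all_order all_algebra.

Set Implicit Arguments.
Unset Strict Implicit.
Unset Printing Implicit Defensive.

Import Order.TTheory GRing.Theory Num.Theory.

(** Since [u_(k l + d) = theta_d (u_k)] at a fixed point [u], peeling off the
    base-[l] digits [n_k ... n_0] of [n] gives
    [u_n = (theta_(n_0) o ... o theta_(n_k)) (u_0)], and the same holds with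
    [u_(-1)] in place of [u_0] for negative [n], the infinite prefix of digits
    [l-1] being harmless because [theta_(l-1)] fixes [u_(-1)]. Reading the least
    significant digit first, an automaton therefore only has to remember the
    composite of the column maps read so far: its states are the elements of
    the semigroup, it starts at the identity, digit [d] sends [f] to
    [f o theta_d], and the outputs evaluate [f] at [u_0] or [u_(-1)]
    ([semigroup_dfa_generates]).

    For minimality, write each [f] in the semigroup as the composite along a
    word [w_f], and let an arbitrary automaton generating [u] read [w_f] from
    the initial state of a side of [u] on which all letters occur. If the letter
    [a] sits at position [n] of that side, appending [w_f] to the digits of [n]
    gives the digits of a position carrying [f a]; so the state reached after
    [w_f] determines [f a] for every [a], and distinct [f] reach distinct states
    ([leq_card_semigroup]).

    The delicate point is that appending digits must commute with taking
    expansions. For [n > 0] it does ([expansion_rcons]). For [-m] it can fail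
    when [m] is a power of [l], as [m l - d] may have no more digits than [m];
    it never fails otherwise ([neg_expansion_rcons]). The simplified form is
    used to find every letter at a position [-m] with [m] not a power of [l]
    ([letter_off_powers]). *)

(** * The semigroup as composites of columns along words *)

Section WordMaps.

Variables (l : nat) (A : finType) (theta : substitution l A).

(** The head of a word is its most significant digit, so its column is the
    innermost factor of the composite. *)
Definition word_map (w : seq 'I_l) : {ffun A -> A} :=
  [ffun a => foldl (fun b d => column theta d b) a w].

Lemma word_map_nil : word_map [::] = ffun_id A.
Proof. by apply/ffunP => a; rewrite !ffunE. Qed.

Lemma word_map_cat (v w : seq 'I_l) :
  word_map (v ++ w) = ffun_comp (word_map w) (word_map v).
Proof. by apply/ffunP => a; rewrite !ffunE foldl_cat. Qed.

Lemma word_map_seq1 (d : 'I_l) : word_map [:: d] = column theta d.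
Proof. by apply/ffunP => a; rewrite !ffunE /= ffunE. Qed.

Lemma word_map_cons (d : 'I_l) (w : seq 'I_l) :
  word_map (d :: w) = ffun_comp (word_map w) (column theta d).
Proof. by rewrite -cat1s word_map_cat word_map_seq1. Qed.

Lemma word_map_consE (d : 'I_l) (w : seq 'I_l) (a : A) :
  word_map (d :: w) a = word_map w (column theta d a).
Proof. by rewrite word_map_cons ffunE. Qed.

Lemma word_map_rconsE (d : 'I_l) (w : seq 'I_l) (a : A) :
  word_map (rcons w d) a = column theta d (word_map w a).
Proof. by rewrite -cats1 word_map_cat word_map_seq1 ffunE. Qed.

Lemma ffun_id_semigroup : ffun_id A \in semigroup theta.
Proof.
apply/bigcapP => G /andP[/subsetP sXG _].
by apply: sXG; rewrite !inE eqxx.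
Qed.

Lemma column_semigroup (d : 'I_l) : column theta d \in semigroup theta.
Proof.
apply/bigcapP => G /andP[/subsetP sXG _].
by apply: sXG; rewrite !inE imset_f ?orbT.
Qed.

Lemma ffun_comp_semigroup (f g : {ffun A -> A}) :
  f \in semigroup theta -> g \in semigroup theta ->
  ffun_comp f g \in semigroup theta.
Proof.
move=> /bigcapP Sf /bigcapP Sg; apply/bigcapP => G G_ok.
have /andP[_ /forall_inP/(_ f (Sf G G_ok))/forall_inP] := G_ok.
by apply; exact: Sg.
Qed.

(** The composites along words are the points reachable from the identity in
    this finite graph; reachability being decidable, they form a finite set
    that can be compared with the intersection defining the semigroup. *)
Definition column_step : rel {ffun A -> A} :=
  fun f g => [exists d, g == ffun_comp f (column theta d)].

Lemma column_step_connectP (f : {ffun A -> A}) :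
  reflect (exists w, f = word_map w) (connect column_step (ffun_id A) f).
Proof.
apply: (iffP idP) => [/connectP[p]|[w ->{f}]].
  rewrite -word_map_nil; elim: p [::] => [w _ ->|g p IHp w]; first by exists w.
  case/andP=> /existsP[d /eqP->]; rewrite -word_map_cons; exact: IHp.
elim: w => [|d w IHw]; first by rewrite word_map_nil.
apply: connect_trans IHw (connect1 _).
by apply/existsP; exists d; rewrite word_map_cons.
Qed.

Lemma semigroupP (f : {ffun A -> A}) :
  reflect (exists w, f = word_map w) (f \in semigroup theta).
Proof.
apply: (iffP idP) => [/bigcapP Sf|[w ->{f}]]; last first.
  elim: w => [|d w IHw]; first by rewrite word_map_nil ffun_id_semigroup.
  by rewrite word_map_cons ffun_comp_semigroup ?column_semigroup.
suff: f \in [set g | connect column_step (ffun_id A) g].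
  by rewrite inE => /column_step_connectP.
apply: Sf; apply/andP; split.
  apply/subsetP => g /setU1P[->|/imsetP[d _ ->]]; rewrite inE //.
  by apply/column_step_connectP; exists [:: d]; rewrite word_map_seq1.
apply/forall_inP => g; rewrite inE => /column_step_connectP[v ->].
apply/forall_inP => h; rewrite inE => /column_step_connectP[w ->].
rewrite inE; apply/column_step_connectP.
by exists (w ++ v); rewrite word_map_cat.
Qed.

Definition semigroup_id : semigroup_type theta :=
  exist _ (ffun_id A) ffun_id_semigroup.

(** Digits arrive least significant first, so each new column is composed on
    the inside. *)
Definition semigroup_dfa : dfa (semigroup_type theta) 'I_l :=
  Dfa (fun f d => exist _ (ffun_comp (val f) (column theta d))
        (ffun_comp_semigroup (valP f) (column_semigroup d)))
      [set semigroup_id].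

Lemma semigroup_dfa_run (w : seq 'I_l) :
  val (reverse_run semigroup_dfa semigroup_id w) = word_map w.
Proof.
elim: w => [|d w IHw]; first by rewrite word_map_nil.
by rewrite word_map_cons -IHw.
Qed.

(** A lower bound on the size of any automaton: if after any low-order word [w]
    the high-order digits [v] extract the image of [a], then the state reached
    along [w] determines the composite along [w], and choosing one word per
    element of the semigroup injects the semigroup into the states. *)
Lemma leq_card_semigroup (Q : finType) (N : dfa Q 'I_l) (s : Q)
    (omega : Q -> A) :
  (forall a : A, exists v : seq 'I_l,
     forall w, omega (reverse_run N s (v ++ w)) = word_map w a) ->
  #|semigroup_type theta| <= #|Q|.
Proof.
move=> prefix.
have word_of (f : semigroup_type theta) : exists w, val f == word_map w.
  by have /semigroupP[w ->] := valP f; exists w.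
pose state f := reverse_run N s (xchoose (word_of f)).
apply: (leq_card state) => f g eq_fg; apply/val_inj/ffunP => a.
have [v vP] := prefix a.
rewrite (eqP (xchooseP (word_of f))) (eqP (xchooseP (word_of g))) -!vP.
rewrite /reverse_run !foldr_cat; congr (omega (foldr _ _ _)); exact: eq_fg.
Qed.

End WordMaps.

(** * Appending a digit to an expansion *)

Section Expansions.

Variables (l : nat) (hl : 1 < l).

Lemma digit_wordS (j n : nat) :
  digit_word hl j.+1 n = rcons (digit_word hl j (n %/ l)) (residue hl n).
Proof.
rewrite /digit_word -rev_cons /mkseq /= expn0 divn1; congr (rev (_ :: _)).
rewrite (iotaDl 1 0) -map_comp; apply: eq_map => i /=.
by rewrite add1n expnS divnMA.
Qed.

Lemma digit_word_rcons (j n : nat) (d : 'I_l) :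
  digit_word hl j.+1 (n * l + d) = rcons (digit_word hl j n) d.
Proof.
rewrite digit_wordS divnMDl ?(ltnW hl) // divn_small ?ltn_ord // addn0.
by congr rcons; apply: val_inj; rewrite /= modnMDl modn_small.
Qed.

(** Positivity matters: the expansion of 0 is the word [0], while that of a
    digit [d] is [d] alone. *)
Lemma expansion_rcons (n : nat) (d : 'I_l) :
  0 < n -> expansion hl (n * l + d) = rcons (expansion hl n) d.
Proof.
move=> n_gt0; rewrite -digit_word_rcons /expansion /expansion_length.
suff -> : trunc_log l (n * l + d) = (trunc_log l n).+1 by [].
have /andP[lo hi] := trunc_log_bounds hl n_gt0.
apply: trunc_log_eq => //; rewrite expnSr; apply/andP; split.
  by apply: leq_trans (leq_addr _ _); rewrite leq_mul2r lo orbT.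
rewrite [X in _ < X]expnSr.
apply: (@leq_trans (n.+1 * l)); first by rewrite mulSn addnC ltn_add2r.
by rewrite leq_mul2r hi orbT.
Qed.

(** The hypothesis says that [m] is positive and not a power of [l]. With
    [l ^ e < m < l ^ e.+1] one gets [l ^ e.+1 < m * l - d < l ^ e.+2], so that
    exactly one digit is added; for [m = l ^ e] and [d > 0] the lower bound
    fails and no digit is added. The hypothesis passes to [m * l - d], which
    lets whole words be appended. *)
Lemma neg_expansion_rcons (m : nat) (d : 'I_l) :
  l ^ trunc_log l m < m ->
  neg_expansion hl (m * l - d) = rcons (neg_expansion hl m) d /\
  l ^ trunc_log l (m * l - d) < m * l - d.
Proof.
move=> lo; have m_gt0 : 0 < m by exact: leq_ltn_trans lo.
have /andP[_ hi] := trunc_log_bounds hl m_gt0.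
have dl := ltn_ord d.
have lo' : l ^ (trunc_log l m).+1 < m * l - d.
  rewrite expnSr ltn_subRL.
  apply: (@leq_trans ((l ^ trunc_log l m).+1 * l)); last first.
    by rewrite leq_mul2r lo orbT.
  by rewrite mulSn ltn_add2r.
have hi' : m * l < l ^ (trunc_log l m).+2.
  by rewrite [X in _ < X]expnSr ltn_mul2r hi (ltnW hl).
have log_eq : trunc_log l (m * l - d) = (trunc_log l m).+1.
  apply: trunc_log_eq => //; rewrite (ltnW lo') /=.
  by apply: leq_ltn_trans hi'; exact: leq_subr.
rewrite log_eq; split=> //; rewrite /neg_expansion /expansion_length log_eq.
rewrite -digit_word_rcons; congr digit_word.
rewrite [in LHS]expnSr mulnBl subnA ?(ltnW hi') //; last first.
- by rewrite -expnSr; apply: ltnW.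
- by apply: leq_trans (ltnW dl) _; rewrite leq_pmull.
Qed.

End Expansions.

(** * Generation and minimality at a fixed point *)

Section FixedPoints.

Variables (l : nat) (hl : 1 < l) (A : finType) (theta : substitution l A).
Variables (u : int -> A) (fix_u : fixed_point hl theta u).

Lemma fixed_point_digit (k : int) (d : 'I_l) :
  u (k * l%:Z + d%:Z)%R = column theta d (u k).
Proof. by rewrite -fix_u extendE. Qed.

Lemma fixed_point_digit_word (p : int) (j n : nat) : n < l ^ j ->
  u (p * (l ^ j)%:Z + n%:Z)%R = word_map theta (digit_word hl j n) (u p).
Proof.
elim: j n => [|j IHj] n lt_n.
  move: lt_n; rewrite expn0 ltnS leqn0 => /eqP->.
  by rewrite mulr1 addr0 (word_map_nil theta) ffunE.
rewrite digit_wordS word_map_rconsE -IHj; last first.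
  by rewrite ltn_divLR ?(ltnW hl) // -expnSr.
rewrite -fixed_point_digit; congr u.
rewrite [in RHS]mulrDl -mulrA -addrA; congr (_ * _ + _)%R.
  by rewrite -PoszM -expnSr.
by rewrite -PoszM -PoszD -divn_eq.
Qed.

Lemma fixed_point_expansion (n : nat) :
  u n%:Z%R = word_map theta (expansion hl n) (u 0%R).
Proof.
rewrite -fixed_point_digit_word ?mul0r ?add0r //.
exact: trunc_log_ltn.
Qed.

Lemma fixed_point_neg_expansion (m : nat) : 0 < m ->
  u (- m%:Z)%R = word_map theta (neg_expansion hl m) (u (-1)%R).
Proof.
move=> m_gt0; have lt_m := ltnW (trunc_log_ltn m hl).
rewrite -fixed_point_digit_word; last first.
  by rewrite ltn_subrL m_gt0 expn_gt0 ltnW.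
by rewrite -subzn // mulN1r addKr.
Qed.

(** Position -1 is [(-1) * l + (l - 1)]. *)
Lemma fixed_point_last_digit :
  column theta (last_digit hl) (u (-1)%R) = u (-1)%R.
Proof.
rewrite -fixed_point_digit /= modn_small ?prednK ?(ltnW hl) //; congr u.
by rewrite mulN1r -subn1 -subzn ?(ltnW hl) // addKr.
Qed.

Lemma semigroup_dfa_generates :
  generates hl (semigroup_dfa theta)
    (fun f => val f (u (-1)%R)) (fun f => val f (u 0%R)) u.
Proof.
exists (semigroup_id theta), (semigroup_id theta); rewrite inE.
split=> // [n | m m_gt0]; rewrite semigroup_dfa_run.
  exact: fixed_point_expansion.
by rewrite word_map_consE fixed_point_last_digit fixed_point_neg_expansion.
Qed.

Lemma expansion_cat (n : nat) (w : seq 'I_l) : 0 < n ->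
  exists n', expansion hl n' = expansion hl n ++ w /\
    u n'%:Z%R = word_map theta w (u n%:Z%R).
Proof.
elim: w n => [|d w IHw] n n_gt0.
  by exists n; rewrite cats0 (word_map_nil theta) ffunE.
have [|n' [exp_n' u_n']] := IHw (n * l + d).
  by rewrite addn_gt0 muln_gt0 n_gt0 ltnW.
exists n'; rewrite exp_n' u_n' expansion_rcons // cat_rcons word_map_consE.
by rewrite -fixed_point_digit.
Qed.

Lemma neg_expansion_cat (m : nat) (w : seq 'I_l) : l ^ trunc_log l m < m ->
  exists2 m', 0 < m' & neg_expansion hl m' = neg_expansion hl m ++ w /\
    u (- m'%:Z)%R = word_map theta w (u (- m%:Z)%R).
Proof.
elim: w m => [|d w IHw] m lo.
  exists m; first exact: leq_ltn_trans lo.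
  by rewrite cats0 (word_map_nil theta) ffunE.
have [exp_d lo_d] := neg_expansion_rcons hl d lo.
have [m' m'_gt0 [exp_m' u_m']] := IHw _ lo_d.
exists m' => //; rewrite exp_m' u_m' exp_d cat_rcons word_map_consE.
rewrite -fixed_point_digit -subzn; first by rewrite opprB addrC mulNr PoszM.
apply: leq_trans (ltnW (ltn_ord d)) _.
by rewrite leq_pmull // (leq_ltn_trans _ lo).
Qed.

(** Let [c = u_(-1)]. By idempotence of [theta_0], the position [- l ^ j]
    carries [theta_0 c] for all [j > 0], so only the letter [theta_0 c] can be
    confined to such positions. If [c] occurs at some [-m] with [m] not a power
    of [l], then [theta_0 c] occurs at [- m l]. Otherwise [c] occurs at some
    [- l ^ j] with [j > 0], so that [c = theta_0 c], and then
    [c = theta_(l-1) c] occurs at [(- l) l + (l - 1) = - (l ^ 2 - l + 1)]. *)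
Lemma letter_off_powers (hsimp : simplified hl theta) :
  (forall a : A, exists2 n : int, (n < -1)%R & u n = a) ->
  forall a : A, exists2 m, l ^ trunc_log l m < m & u (- m%:Z)%R = a.
Proof.
have [idem0 _] := hsimp => full.
pose c := u (-1)%R.
have u_power j : 0 < j -> u (- (l ^ j)%:Z)%R = column theta (first_digit hl) c.
  have step k : u (- (k * l)%:Z)%R =
      column theta (first_digit hl) (u (- k%:Z)%R).
    by rewrite -fixed_point_digit /= mod0n addr0 PoszM mulNr.
  elim: j => // -[_ _|j IHj _]; first by rewrite expnSr step.
  by rewrite expnSr step IHj //; exact: idem0.
have occurs a : (exists2 m, l ^ trunc_log l m < m & u (- m%:Z)%R = a) \/
    a = column theta (first_digit hl) c.
  have [n n_lt <-] := full a.
  have [m -> m_gt1] : exists2 m, n = (- m%:Z)%R & 1 < m.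
    by case: n n_lt => // n n_lt; exists n.+1.
  have [lo|hi] := ltnP (l ^ trunc_log l m) m; first by left; exists m.
  have m_eq : m = l ^ trunc_log l m.
    by apply/eqP; rewrite eqn_leq hi trunc_logP // ltnW.
  right; rewrite m_eq u_power // lt0n; apply: contraTneq m_gt1 => log0.
  by rewrite m_eq log0.
move=> a; case: (occurs a) => // ->.
case: (occurs c) => [[m lo u_m] | c_eq].
  have [_] := neg_expansion_rcons hl (first_digit hl) lo.
  rewrite /= mod0n subn0 => lo'; exists (m * l) => //.
  by rewrite PoszM -mulNr -u_m -fixed_point_digit /= mod0n addr0.
have lt_ll : l < l * l - l.-1.
  rewrite ltn_subRL; apply: (@leq_trans (2 * l)); last first.
    by rewrite leq_mul2r hl orbT.
  by rewrite mul2n -addnn ltn_add2r prednK // ltnW.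
exists (l * l - l.-1).
  suff -> : trunc_log l (l * l - l.-1) = 1 by rewrite expn1.
  apply: trunc_log_eq => //; rewrite expn1 (ltnW lt_ll) /= -mulnn.
  by rewrite ltn_subrL -subn1 subn_gt0 hl muln_gt0 ltnW.
rewrite -c_eq -[RHS]fixed_point_last_digit -/c c_eq -(u_power 1) // expn1.
rewrite -fixed_point_digit /= modn_small ?prednK ?(ltnW hl) //.
rewrite -subzn ?opprB; first by rewrite addrC mulNr PoszM.
by apply: leq_trans (leq_pred l) _; rewrite leq_pmull // ltnW.
Qed.

Lemma semigroup_dfa_minimal (hsimp : simplified hl theta) :
  full_on_one_side u -> minimal_for hl (semigroup_dfa theta) u.
Proof.
move=> full; split.
  by do 2!eexists; exact: semigroup_dfa_generates.
move=> Q N omega_l omega_r [s0 [s1 [_ _ gen_r gen_l]]].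
case: full => full.
  apply: (@leq_card_semigroup l A theta Q N s0 omega_r) => a.
  have [[n|//] n_gt0 <-] := full a; exists (expansion hl n) => w.
  have [n' [<- <-]] := expansion_cat w n_gt0.
  by rewrite gen_r.
apply: (@leq_card_semigroup l A theta Q N s1 omega_l) => a.
have [m lo <-] := letter_off_powers hsimp full a.
exists (last_digit hl :: neg_expansion hl m) => w; rewrite cat_cons.
have [m' m'_gt0 [<- <-]] := neg_expansion_cat w lo.
by rewrite gen_l.
Qed.

End FixedPoints.

Theorem theorem12 (l : nat) (hl : 1 < l) (A : finType)
    (theta : substitution l A) (hsimp : simplified hl theta) :
  exists M : dfa (semigroup_type theta) 'I_l,
    forall (u : int -> A) (u_l u_r : A),
      fixed_point hl theta u ->
      u (-1)%R = u_l -> u 0%R = u_r ->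
      (exists omega_l omega_r : semigroup_type theta -> A,
         generates hl M omega_l omega_r u) /\
      (full_on_one_side u -> minimal_for hl M u).
Proof.
exists (semigroup_dfa theta) => u u_l u_r fix_u _ _; split.
  by do 2!eexists; exact: semigroup_dfa_generates fix_u.
exact: semigroup_dfa_minimal.
Qed.
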